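(* Let $r\geq 3$ be an integer and let $G$ be a finite, undirected graph without loops or multiple edges such that $\Delta(G)-\delta(G)\leq 1$ and $\chi'(G)=\Delta(G)=r$. Let $n=|V(G)|$ and $n_r=|\{v\in V(G): d_G(v)=r\}|$. Then there exists a set $R\subseteq V(G)$ with $$|R|\geq \left\lceil\frac{(r-1)n_r+n}{r}\right\rceil$$ such that $G$ has an $R$-sequential $r$-coloring.
   Context: All graphs are finite, undirected, without loops or multiple edges. $V(G)$ and $E(G)$ are the vertex and edge sets of $G$, $d_G(v)$ is the degree of a vertex $v$, $\Delta(G)$ and $\delta(G)$ are the maximum and minimum vertex degrees, and $\chi'(G)$ is the chromatic index (the least number of colors in a proper edge-coloring of $G$). A proper edge-coloring of $G$ is a map $\alpha:E(G)\to\mathbb{N}$ (positive integers) with $\alpha(e)\neq\alpha(e')$ for every pair of adjacent edges $e,e'$. For $R\subseteq V(G)$, an $R$-sequential $t$-coloring of $G$ is a proper edge-coloring of $G$ with colors $1,\ldots,t$ such that, for each vertex $v\in R$, the edges incident to $v$ are colored by the colors $1,\ldots,d_G(v)$ (that is, the set of colors appearing on the edges incident to $v$ is exactly $\{1,\ldots,d_G(v)\}$). *)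

(* Defs.v *)
From mathcomp Require Import all_boot.

Set Implicit Arguments.
Unset Strict Implicit.
Unset Printing Implicit Defensive.

Record sgraph := SGraph {
  vertex :> finType;
  adj : rel vertex;
  adj_sym : symmetric adj;
  adj_irrefl : irreflexive adj
}.

Section Graph.
Variable G : sgraph.

Definition edges : {set {set G}} :=
  [set e : {set G} | [exists x, exists y, adj x y && (e == [set x; y])]].

Definition edge := {e : {set G} | e \in edges}.

Definition incident (v : G) (e : edge) : bool := v \in val e.

Definition adjacent_edges (e e' : edge) : bool :=
  (e != e') && [exists v, incident v e && incident v e'].

Definition deg (v : G) : nat := #|[set u | adj v u]|.

Definition max_degree : nat := \max_(v : G) deg v.

(* Every degree is less than #|G|, so the default value #|G| never affects the
   minimum when G has a vertex. *)
Definition min_degree : nat := \big[minn/#|G|]_(v : G) deg v.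

Definition proper_edge_coloring (C : eqType) (a : edge -> C) : Prop :=
  forall e e', adjacent_edges e e' -> a e != a e'.

Definition edge_colorable (k : nat) : bool :=
  [exists a : {ffun edge -> 'I_k},
    [forall e, forall e', adjacent_edges e e' ==> (a e != a e')]].

Lemma edge_colorableP (k : nat) :
  reflect (exists a : edge -> 'I_k, proper_edge_coloring a) (edge_colorable k).
Proof.
apply: (iffP existsP) => [[a /forallP aP]|[a aP]].
  by exists a => e e' ee'; move/forallP: (aP e) => /(_ e') /implyP; apply.
exists [ffun e => a e]; apply/forallP => e; apply/forallP => e'.
by apply/implyP => ee'; rewrite !ffunE; apply: aP.
Qed.

Lemma edge_colorable_exists : exists k, edge_colorable k.
Proof.
exists #|{: edge}|; apply/edge_colorableP; exists enum_rank => e e' /andP[ne _].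
by rewrite (inj_eq enum_rank_inj).
Qed.

Definition chromatic_index : nat := ex_minn edge_colorable_exists.

Definition colors_at (a : edge -> nat) (v : G) : seq nat :=
  [seq a e | e in [pred e | incident v e]].

Definition sequential_coloring (R : {set G}) (t : nat) (a : edge -> nat) : Prop :=
  [/\ proper_edge_coloring a,
      forall e, 1 <= a e <= t
    & forall v, v \in R ->
        forall c, (c \in colors_at a v) = (1 <= c <= deg v)].

End Graph.

(* Main.v *)
(* In a proper edge-coloring with r colors a vertex of degree r misses no color
   and a vertex of degree r - 1 misses exactly one.  By pigeonhole some color c
   is missed by at least (n - n_r) / r vertices; exchanging c with the last
   color r makes all these vertices, and all those of degree r, sequential. *)
Require Import Defs.
From mathcomp Require Import all_boot all_order all_algebra.
From mathcomp Require Import fingroup perm zify.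

Set Implicit Arguments.
Unset Strict Implicit.
Unset Printing Implicit Defensive.

(** Double counting of the pairs [(v, c)] with [c \in M v]: the largest fibre is at least the
    average one. The point [c0] makes [C] nonempty, so that a largest fibre exists. *)
Lemma exists_card_fibre_ge (T C : finType) (M : T -> {set C}) (c0 : C) :
  exists c, \sum_v #|M v| <= #|C| * #|[set v | c \in M v]|.
Proof.
have -> : \sum_v #|M v| = \sum_c #|[set v | c \in M v]|.
  rewrite (eq_bigr (fun v => \sum_c (c \in M v : nat))) => [|v _]; last first.
    by rewrite -sum1_card big_mkcond; apply: eq_bigr => c _; case: ifP.
  rewrite exchange_big; apply: eq_bigr => c _.
  by rewrite -sum1_card [RHS]big_mkcond; apply: eq_bigr => v _; rewrite inE; case: ifP.
have [c _ c_max] := @arg_maxnP C c0 predT (fun c => #|[set v | c \in M v]|) isT.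
by exists c; rewrite -sum_nat_const; apply: leq_sum => d _; apply: c_max.
Qed.

Lemma leq_min_degree (G : sgraph) (v : G) : min_degree G <= deg v.
Proof.
rewrite /min_degree; have : v \in index_enum G by rewrite mem_index_enum.
elim: (index_enum G) => // u s IHs; rewrite in_cons big_cons geq_min.
by case/predU1P => [->|/IHs ->]; rewrite ?leqnn ?orbT.
Qed.

Lemma leq_max_degree (G : sgraph) (v : G) : deg v <= max_degree G.
Proof. exact: leq_bigmax. Qed.

Lemma card_incident (G : sgraph) (v : G) : #|[set e : edge G | incident v e]| = deg v.
Proof.
have val_incident : [set val e | e in [set e : edge G | incident v e]]
    = [set [set v; u] | u in [set u | adj v u]].
  apply/setP => s; apply/imsetP/imsetP => [[e]|[u]].
    rewrite inE /incident => ve ->; have := valP e; rewrite inE.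
    case/existsP => x /existsP[y /andP[xy /eqP exy]].
    move: ve; rewrite exy !inE => /orP[] /eqP ->.
      by exists y; rewrite ?inE.
    by exists x; rewrite ?inE 1?adj_sym // setUC.
  rewrite inE => vu ->.
  have E : [set v; u] \in edges G.
    by rewrite inE; apply/existsP; exists v; apply/existsP; exists u; rewrite vu eqxx.
  by exists (exist (fun s => s \in edges G) _ E); rewrite // inE /incident /= !inE eqxx.
(* The map from a neighbour [u] to [[set v; u]] is injective because [u] differs from [v], there
   being no loops. *)
rewrite -(card_imset _ val_inj) val_incident card_in_imset // => u w.
rewrite !inE => vu vw /setP/(_ u); rewrite !inE eqxx orbT.
by have [uv|_ /esym/eqP //] := eqVneq u v; rewrite uv adj_irrefl in vu.
Qed.

Definition missing_colors (G : sgraph) (C : finType) (a : edge G -> C) (v : G) : {set C} :=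
  ~: [set a e | e in [set e | incident v e]].

(** Two edges at [v] are adjacent, so a proper coloring is injective on the edges at [v]. *)
Lemma card_missing_colors (G : sgraph) (C : finType) (a : edge G -> C) (v : G) :
  proper_edge_coloring a -> #|missing_colors a v| = #|C| - deg v.
Proof.
move=> aP; rewrite cardsCs setCK card_in_imset ?card_incident // => e e'.
rewrite !inE => ve ve' aee'; apply/eqP; apply: contraT => nee'.
have /aP : adjacent_edges e e'.
  by rewrite /adjacent_edges nee'; apply/existsP; exists v; rewrite ve.
by rewrite aee' eqxx.
Qed.

Lemma mem_colors_at_comp (G : sgraph) (C : finType) (a : edge G -> C)
    (f : C -> nat) (v : G) (k : nat) :
  reflect (exists2 i, i \notin missing_colors a v & k = f i)
          (k \in colors_at (f \o a) v).
Proof.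
apply: (iffP mapP) => [[e]|[i]].
  rewrite mem_enum => ve ->; exists (a e) => //.
  by rewrite inE negbK; apply/imsetP; exists e; rewrite ?inE.
rewrite inE negbK => /imsetP[e]; rewrite inE => ve -> ->.
by exists e; rewrite ?mem_enum.
Qed.

Lemma sequential_of_missing_color (G : sgraph) (m : nat)
    (a : edge G -> 'I_m.+1) (c : 'I_m.+1) :
  proper_edge_coloring a -> (forall v : G, m <= deg v <= m.+1) ->
  exists b : edge G -> nat,
    sequential_coloring [set v | (deg v == m.+1) || (c \in missing_colors a v)]
      m.+1 b.
Proof.
(* The successor shifts the ordinals [0..m] to the colors [1..m.+1], so [ord_max] stands for the
   last color. *)
move=> aP deg_bounds; pose f i := (tperm c ord_max i : 'I_m.+1).+1.
(* A transposition is its own inverse, which yields the preimage; only [c] is sent to the last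
   color. *)
have fK k : 0 < k <= m.+1 -> exists2 i, f i = k & (i == c) = (k == m.+1).
  case: k => // k km; exists (tperm c ord_max (Ordinal (km : k < m.+1))).
    by rewrite /f tpermK.
  by rewrite -{2}[c](tpermR c ord_max) tpermC (inj_eq perm_inj) -val_eqE.
exists (f \o a); split=> [e e' ee'|e|v].
- by rewrite eqSS /= val_eqE (inj_eq perm_inj) aP.
- exact: ltn_ord.
rewrite inE => vR k; have card_miss := card_missing_colors v aP.
rewrite card_ord in card_miss.
have miss i : (i \in missing_colors a v) = (deg v == m) && (i == c).
  have [dv|ndv] := eqVneq (deg v) m.
    rewrite dv ltn_eqF //= in vR.
    have /eqP/cards1P[d Md] : #|missing_colors a v| = 1 by lia.
    by move: vR; rewrite Md !inE => /eqP ->.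
  have /cards0_eq -> : #|missing_colors a v| = 0 by have := deg_bounds v; lia.
  by rewrite inE.
apply/mem_colors_at_comp/idP => [[i]|k_le].
  rewrite miss => i_seen ->; rewrite /f /=.
  have := deg_bounds v; have := ltn_ord (tperm c ord_max i).
  have [dv|] := eqVneq (deg v) m; last by lia.
  rewrite dv eqxx /= in i_seen.
  (* At a vertex of degree [m] the color seen is not [c], so its image is not the last color. *)
  suff : (tperm c ord_max i : nat) != m by lia.
  change (val (tperm c ord_max i) != val (ord_max : 'I_m.+1)).
  by rewrite val_eqE -{2}(tpermL c ord_max) (inj_eq perm_inj).
(* If [deg v] is [m], then [k <= m] forces [i != c], so [i] is seen; if it is [m.+1], every color is
   seen. *)
have [|i fi ic] := fK k; first by have := deg_bounds v; lia.
by exists i; rewrite ?fi // miss ic; lia.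
Qed.

Theorem theorem3 (r : nat) (G : sgraph) :
  3 <= r ->
  max_degree G - min_degree G <= 1 ->
  chromatic_index G = max_degree G ->
  max_degree G = r ->
  let n := #|G| in
  let n_r := #|[set v : G | deg v == r]| in
  exists R : {set G},
    (Num.ceil (((r%:R - 1) * n_r%:R + n%:R) / r%:R : rat) <= #|R|%:Z)%R /\
    exists a : edge G -> nat, sequential_coloring R r a.
Proof.
case: r => // m _ near_regular index_eq max_eq n n_r.
have /edge_colorableP[a aP] : edge_colorable G m.+1.
  by rewrite -max_eq -index_eq /chromatic_index; case: ex_minnP.
have deg_bounds (v : G) : m <= deg v <= m.+1.
  have := leq_min_degree v; have := leq_max_degree v; lia.
have [c c_missed] := exists_card_fibre_ge (missing_colors a) ord0.
exists [set v | (deg v == m.+1) || (c \in missing_colors a v)].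
split; last exact: sequential_of_missing_color.
set R := [set v | _]; set Mc := [set v | c \in _] in c_missed.
have card_R : #|R| = n_r + #|Mc|.
  have -> : R = [set v | deg v == m.+1] :|: Mc by apply/setP=> v; rewrite !inE.
  rewrite cardsU (_ : _ :&: _ = set0) ?cards0 ?subn0 //.
  apply/setP=> v; rewrite !inE; apply/negP=> /andP[/eqP dv cM].
  have := card_missing_colors v aP.
  by rewrite dv card_ord subnn => /cards0_eq/setP/(_ c); rewrite !inE cM.
(* Each vertex contributes exactly 1 on the left: to [n_r] if its degree is [m.+1], to the sum if it
   is [m]. *)
have sum_miss : n_r + \sum_v #|missing_colors a v| = n.
  rewrite /n_r -sum1_card big_mkcond -big_split /n -sum1_card.
  apply: eq_bigr => v _; rewrite (card_missing_colors _ aP) card_ord inE.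
  by have := deg_bounds v; case: eqP => /=; lia.
(* With [r = m.+1], the product [r * #|R|] is [r * n_r + r * #|Mc|], and [r * #|Mc|] is at least
   [n - n_r]. *)
have bound : m * n_r + n <= #|R| * m.+1.
  by move: c_missed; rewrite card_ord card_R; lia.
rewrite Num.Theory.ceil_le_int ?Num.Theory.num_real //.
rewrite Num.Theory.ler_pdivrMr ?Num.Theory.ltr0n //.
rewrite -GRing.natr1 GRing.addrK GRing.natr1 -!(pmulrn, GRing.natrM, GRing.natrD).
by rewrite Num.Theory.ler_nat.
Qed.
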